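(* Let $\mathbb{K}\subseteq\mathbb{C}$ be a subfield (of characteristic $0$), let $f\in\mathbb{K}[x,y]$ be a nonconstant polynomial, and let $D$ be the greatest common divisor of $f_x$ and $f_y$ in $\mathbb{K}[x,y]$. If $f$ belongs to the Jacobian ideal $J(f)=\langle f_x,f_y\rangle$ in $\mathbb{K}[x,y]$, then there exists $\mathcal{X}_*\in V_f$ such that the $\mathbb{K}[x,y]$-module $V_f$ is freely generated by the polynomial vector field $\mathcal{X}_0/D=-\frac{f_y}{D}\frac{\partial}{\partial x}+\frac{f_x}{D}\frac{\partial}{\partial y}$ and $\mathcal{X}_*$.
   Context: Write $f_x=\frac{\partial f}{\partial x}$, $f_y=\frac{\partial f}{\partial y}$, and $\mathcal{X}_0=-f_y\frac{\partial}{\partial x}+f_x\frac{\partial}{\partial y}$. $V_f$ denotes the $\mathbb{K}[x,y]$-module of all polynomial vector fields $\mathcal{X}=P\frac{\partial}{\partial x}+Q\frac{\partial}{\partial y}$ with $P,Q\in\mathbb{K}[x,y]$ for which there exists $k\in\mathbb{K}[x,y]$ with $Pf_x+Qf_y=kf$, i.e. those admitting the curve $\{f=0\}$ as an invariant curve. ''Freely generated by'' means that the listed elements form a basis of the module. *)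

(* Defs.v *)
From HB Require Import structures.
From mathcomp Require Import all_boot all_order all_algebra.
From mathcomp Require Import reals complex mpoly.

Set Implicit Arguments.
Unset Strict Implicit.
Unset Printing Implicit Defensive.

Import GRing.Theory.
Local Open Scope ring_scope.

Section RingNotions.
Variable A : comNzRingType.
Implicit Types a b d : A.

Definition divides d a : Prop := exists q, a = q * d.

(* "d is a greatest common divisor": gcds are only defined up to a unit. *)
Definition is_gcd d a b : Prop :=
  [/\ divides d a, divides d b
    & forall e, divides e a -> divides e b -> divides e d].

(* The listed vectors form a basis of the submodule [V]. The equivalence says
   that they lie in [V], that they span it, and that [V] is a submodule. *)
Definition freely_generated_by (M : lmodType A) (V : M -> Prop)
    (n : nat) (v : n.-tuple M) : Prop :=
  (forall m : M, V m <-> exists c : 'I_n -> A, m = \sum_i c i *: tnth v i)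
  /\ (forall c : 'I_n -> A,
        \sum_i c i *: tnth v i = 0 -> forall i, c i = 0).

End RingNotions.

Section PlaneVectorFields.
Variable K : fieldType.
Implicit Types f : {mpoly K[2]}.

(* x and y are the variables of index 0 and 1 *)
Definition dx f : {mpoly K[2]} := mderiv (@Ordinal 2 0 isT) f.
Definition dy f : {mpoly K[2]} := mderiv (@Ordinal 2 1 isT) f.

Definition nonconstant f : Prop := forall c : K, f <> c%:MP.

(* (P, Q) stands for P d/dx + Q d/dy. The regular modules [_^o] make
   [vfield] a module over K[x,y]; {mpoly K[2]} itself only carries its
   K-module structure. *)
Definition vfield : lmodType {mpoly K[2]} :=
  ({mpoly K[2]}^o * {mpoly K[2]}^o)%type.

Definition hamiltonian f : vfield := (- dy f, dx f).

Definition V_ f (X : vfield) : Prop :=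
  exists k : {mpoly K[2]},
    (X.1 : {mpoly K[2]}) * dx f + (X.2 : {mpoly K[2]}) * dy f = k * f.

Definition in_jacobian_ideal f (g : {mpoly K[2]}) : Prop :=
  exists a b : {mpoly K[2]}, g = a * dx f + b * dy f.

End PlaneVectorFields.

(* Main.v *)
Require Import Defs.
From HB Require Import structures.
From mathcomp Require Import all_boot all_order all_algebra.
From mathcomp Require Import boolp reals complex mpoly ring.
Local Open Scope ring_scope.

Set Implicit Arguments.
Unset Strict Implicit.
Unset Printing Implicit Defensive.
Import GRing.Theory.

(** Write dx f = p D and dy f = q D, so that p and q have no common factor, and
    let f = a (dx f) + b (dy f) be the membership of f in its Jacobian ideal.
    Then f = g D with g = a p + b q, and after division by D the field (P, Q)
    lies in V_f exactly when P p + Q q = k g for some k.  The field (a, b) has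
    k = 1, so subtracting k (a, b) from such a field leaves a solution of
    P p + Q q = 0.  As p and q are coprime in the factorial ring K[x,y]
    ([trivial_syzygies_mpoly2]), this solution is a multiple of (-q, p), which
    is the Hamiltonian field divided by D.  Hence (-q, p) and (a, b) generate
    V_f; they are independent because their determinant is -g, and g is nonzero
    since f is.

    The substance is the statement on syzygies, proved in K[x][y] and carried
    to K[x,y] by an isomorphism.  A syzygy of (p, q) is a pair (u, v) with
    u p = v q.  Among those with v nonzero, choose one of least degree in y and
    then with leading coefficient of least degree in x: its entries have no
    common factor in K[x].  Pseudo-division of any other syzygy by it leaves no
    remainder, so some nonzero c in K[x] times that syzygy is a multiple of
    (u, v); a Gauss lemma ([prime_polyC]) removes c ([cancel_scalar]).
    So all syzygies are multiples of one of them, (u, v)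
    ([syzygies_cyclic]).  In particular (q, p) is the multiple of (u, v) by a
    common divisor of p and q, that is by a unit, hence it generates as well. *)

(** * Coprime elements and their syzygies *)

Definition only_unit_divisors (A : comNzRingType) (p q : A) : Prop :=
  forall e, divides e p -> divides e q -> divides e 1.

(** This is Euclid's lemma for coprime elements, in a form which also gives the
    common cofactor w.  It fails in general domains, where having only units as
    common divisors is too weak. *)
Definition trivial_syzygies (A : comNzRingType) : Prop :=
  forall p q u v : A, only_unit_divisors p q -> u * p = v * q ->
  exists w, u = w * q /\ v = w * p.

Lemma trivial_syzygies_iso (A B : comNzRingType)
    (phi : {rmorphism A -> B}) (psi : {rmorphism B -> A}) :
  cancel phi psi -> cancel psi phi ->
  trivial_syzygies B -> trivial_syzygies A.
Proof.
move=> phiK psiK syzB p q u v pq_coprime uv_syz.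
have [||w [u_def v_def]] := syzB (phi p) (phi q) (phi u) (phi v).
- move=> e [a pE] [b qE].
  have [|| c cE] := pq_coprime (psi e).
  + by exists (psi a); rewrite -rmorphM -pE phiK.
  + by exists (psi b); rewrite -rmorphM -qE phiK.
  by exists (phi c); rewrite -[e in RHS]psiK -rmorphM -cE rmorph1.
- by rewrite -!rmorphM uv_syz.
by exists (psi w); rewrite -{1}[u]phiK -{1}[v]phiK u_def v_def !rmorphM !phiK.
Qed.

Lemma exists_minimal (T : Type) (P : T -> Prop) (m : T -> nat) :
  (exists x, P x) -> exists2 x, P x & forall y, P y -> (m x <= m y)%N.
Proof.
move=> [x Px].
have exn : exists n, `[< exists2 y, P y & m y = n >].
  by exists (m x); apply/asboolP; exists x.
case: (ex_minnP exn) => n /asboolP[y Py <-] y_min.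
by exists y => // z Pz; apply: y_min; apply/asboolP; exists z.
Qed.

(** * Primes of the coefficient ring *)

(** Gauss's lemma: a prime of A stays prime in A[y].  If c divides v w then it
    divides the product of the leading coefficients, hence one of the two; the
    leading term of that factor can then be dropped without affecting
    divisibility by c, which makes the total size smaller. *)
Lemma prime_polyC (A : idomainType) (c : A) (v w : {poly A}) :
  (forall a b : A, divides c (a * b) -> divides c a \/ divides c b) ->
  divides c%:P (v * w) -> divides c%:P v \/ divides c%:P w.
Proof.
move=> c_prime.
pose low (s : {poly A}) : {poly A} := s - lead_coef s *: 'X^((size s).-1).
have div_lead (s t : {poly A}) : divides c (lead_coef s) ->
    divides c%:P (s * t) ->
    divides c%:P (low s * t).
  move=> [a sE] [b stE]; exists (b - a *: 'X^((size s).-1) * t).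
  by rewrite /low !mulrBl stE sE -!mul_polyC polyCM; ring.
have div_back (s : {poly A}) : divides c (lead_coef s) ->
    divides c%:P (low s) -> divides c%:P s.
  move=> [a sE] [b stE]; exists (b + a *: 'X^((size s).-1)).
  by rewrite mulrDl -stE /low sE -!mul_polyC polyCM; ring.
have size_lead (s : {poly A}) : s != 0 ->
    (size (low s) < size s)%N.
  move=> s_neq0.
  rewrite -[X in (_ < X)%N](prednK (n := size s)) ?size_poly_gt0 //.
  rewrite /low ltnS; apply/leq_sizeP => j.
  rewrite leq_eqVlt => /predU1P[<-|lt_j].
    by rewrite coefB coefZ coefXn eqxx mulr1 subrr.
  rewrite coefB coefZ coefXn gtn_eqF // mulr0 subr0 nth_default //.
  by rewrite -(prednK (n := size s)) ?size_poly_gt0.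
have [n] := ubnP (size v + size w)%N.
elim: n v w => // n IH v w size_vw c_vw.
have [->|v_neq0] := eqVneq v 0; first by left; exists 0; rewrite mul0r.
have [->|w_neq0] := eqVneq w 0; first by right; exists 0; rewrite mul0r.
have: divides c (lead_coef v * lead_coef w).
  have [b vwE] := c_vw; exists (lead_coef b).
  by rewrite -lead_coefM vwE lead_coefM lead_coefC.
case/c_prime => c_lead.
- have [|| c_v'|] := IH (low v) w.
  + rewrite -ltnS; apply: leq_trans size_vw.
    by rewrite ltnS -addSn leq_add2r size_lead.
  + exact: div_lead.
  + by left; apply: div_back.
  + by right.
- have [||| c_w'] := IH v (low w).
  + rewrite -ltnS; apply: leq_trans size_vw.
    by rewrite ltnS -addnS leq_add2l size_lead.
  + by rewrite mulrC; apply: div_lead; rewrite // mulrC.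
  + by left.
  + by right; apply: div_back.
Qed.

(** * Syzygies in K[x][y] *)

Section BivariatePolynomials.
Variable K : fieldType.
Implicit Types (c d : {poly K}) (p q u v w : {poly {poly K}}).

(** A nonconstant divisor of least degree is irreducible. *)
Lemma irreducible_factor c : (1 < size c)%N ->
  exists2 d, irreducible_poly d & divides d c.
Proof.
move=> size_c.
have [|d [size_d [a cE]] d_min] :=
  @exists_minimal _ (fun d => (1 < size d)%N /\ divides d c) (fun d => size d).
  by exists c; split=> //; exists 1; rewrite mul1r.
exists d; last by exists a.
split=> // e size_e e_d; rewrite -dvdp_size_eqp //.
have d_neq0 : d != 0 by rewrite -size_poly_gt0 ltnW.
have e_neq0 : e != 0 by apply: contraNneq d_neq0 => e0; rewrite -dvd0p -e0.
rewrite eqn_leq dvdp_leq //=; apply: d_min; split.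
  by rewrite ltn_neqAle eq_sym size_e size_poly_gt0.
by have /dvdpP[b dE] := e_d; exists (a * b); rewrite cE dE mulrA.
Qed.

Lemma irreducible_prime d : irreducible_poly d ->
  forall a b, divides d (a * b) -> divides d a \/ divides d b.
Proof.
move=> d_irr a b /dvdpP d_ab.
have [/dvdpP d_b|d_b] := boolP (d %| b); first by right.
left; apply/dvdpP.
by rewrite -(Gauss_dvdpl _ (q := b)) // irreducible_poly_coprime.
Qed.

(** Only common factors in K[x] are excluded; u and v may well share a factor of
    positive degree in y. *)
Definition primitive_pair u v : Prop :=
  forall d, (1 < size d)%N -> divides d%:P u -> ~ divides d%:P v.

(** The two equations say that (u1, v1) is a multiple of (u, v) up to a
    denominator c in K[x].  An irreducible factor d of c divides both w u and
    w v; since it does not divide both u and v, it divides w by Gauss's lemma,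
    and cancelling it makes c smaller. *)
Lemma cancel_scalar u v u1 v1 c w : primitive_pair u v -> c != 0 ->
  c%:P * u1 = w * u -> c%:P * v1 = w * v ->
  exists w', u1 = w' * u /\ v1 = w' * v.
Proof.
move=> uv_prim; have [n] := ubnP (size c).
elim: n c w => // n IH c w size_c c_neq0 u1E v1E.
have [size_c1|size_c1] := leqP (size c) 1.
  have [a cE] : exists a : K, c = a%:P by exists c`_0; rewrite -size1_polyC.
  have a_neq0 : a != 0 by rewrite cE polyC_eq0 in c_neq0.
  have aVc : (a^-1)%:P%:P * c%:P = 1 by rewrite cE -!polyCM mulVf.
  exists ((a^-1)%:P%:P * w).
  by rewrite -!mulrA -u1E -v1E !mulrA aVc !mul1r.
have [d d_irr [a cE]] := irreducible_factor size_c1.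
have size_d : (1 < size d)%N := d_irr.1.
have d_neq0 : d != 0 by rewrite -size_poly_gt0 ltnW.
have a_neq0 : a != 0 by apply: contraNneq c_neq0 => a0; rewrite cE a0 mul0r.
have d_wu : divides d%:P (w * u).
  by exists (a%:P * u1); rewrite -u1E cE polyCM; ring.
have d_wv : divides d%:P (w * v).
  by exists (a%:P * v1); rewrite -v1E cE polyCM; ring.
have [b wE] : divides d%:P w.
  have [//|d_u] := prime_polyC (irreducible_prime d_irr) d_wu.
  have [//|d_v] := prime_polyC (irreducible_prime d_irr) d_wv.
  by have := uv_prim d size_d d_u.
have dP_neq0 : d%:P != 0 :> {poly {poly K}} by rewrite polyC_eq0.
apply: (IH a b) => //.
- rewrite -ltnS; apply: leq_trans size_c; rewrite ltnS cE size_mul //.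
  by case: (size d) size_d => [|[|k]] // _; rewrite !addnS /= ltnS leq_addr.
- apply: (mulfI dP_neq0).
  by rewrite mulrA -polyCM [d * a]mulrC -cE u1E wE; ring.
- apply: (mulfI dP_neq0).
  by rewrite mulrA -polyCM [d * a]mulrC -cE v1E wE; ring.
Qed.

(** The hypothesis on p ensures that a syzygy with second entry 0 is 0, so that
    a remainder of smaller degree than the minimal v must vanish together with
    the first entry that goes with it. *)
Lemma syzygies_cyclic p q : p != 0 ->
  exists u v, forall u1 v1, u1 * p = v1 * q ->
  exists w, u1 = w * u /\ v1 = w * v.
Proof.
move=> p_neq0.
pose syz (z : {poly {poly K}} * {poly {poly K}}) :=
  z.1 * p = z.2 * q /\ z.2 != 0.
have [|z0 z0_syz z0_min] := @exists_minimal _ syz (fun z => size z.2).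
  by exists (q, p); split=> //=; rewrite mulrC.
have [|[u v] [[/= uv_syz v_neq0] size_v] uv_min] := @exists_minimal _
  (fun z => syz z /\ size z.2 = size z0.2) (fun z => size (lead_coef z.2)).
  by exists z0.
(* Dividing (u, v) by a common factor in K[x] keeps the degree of v in y and
   lowers the degree of its leading coefficient. *)
have uv_prim : primitive_pair u v.
  move=> d size_d [a uE] [b vE].
  have d_neq0 : d != 0 by rewrite -size_poly_gt0 ltnW.
  have b_neq0 : b != 0 by apply: contraNneq v_neq0 => b0; rewrite vE b0 mul0r.
  have ab_syz : syz (a, b).
    split=> //=; apply: (@mulfI _ d%:P); first by rewrite polyC_eq0.
    by rewrite !mulrA ![d%:P * _]mulrC -uE -vE.
  have := uv_min (a, b); rewrite /= -size_v vE mulrC size_Cmul //.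
  move=> /(_ (conj ab_syz erefl)); rewrite lead_coefM lead_coefC.
  rewrite size_mul ?lead_coef_eq0 //; apply/negP; rewrite -ltnNge.
  by case: (size d) size_d => [|[|k]] //= _; rewrite addSn ltnS leq_addl.
exists u, v => u1 v1 uv1_syz.
pose c := lead_coef v ^+ scalp v1 v.
have c_neq0 : c != 0 by rewrite expf_neq0 // lead_coef_eq0.
have v1E : c%:P * v1 = v1 %/ v * v + v1 %% v.
  by rewrite mul_polyC; apply: Pdiv.Idomain.divp_eq.
have r_syz : (c%:P * u1 - v1 %/ v * u) * p = (v1 %% v) * q.
  have -> : v1 %% v = c%:P * v1 - v1 %/ v * v by rewrite v1E; ring.
  by rewrite !mulrBl -!mulrA uv1_syz uv_syz.
have r0 : v1 %% v = 0.
  apply/eqP/negPn/negP => r_neq0.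
  have := z0_min (c%:P * u1 - v1 %/ v * u, v1 %% v) (conj r_syz r_neq0).
  by rewrite -size_v /= leqNgt Pdiv.Idomain.ltn_modp v_neq0.
apply: (cancel_scalar uv_prim c_neq0 (w := v1 %/ v)); last first.
  by rewrite v1E r0 addr0.
move/eqP: r_syz; rewrite r0 mul0r mulf_eq0 (negbTE p_neq0) orbF subr_eq0.
by move/eqP.
Qed.

Lemma trivial_syzygies_polyXY : trivial_syzygies {poly {poly K}}.
Proof.
move=> p q u v pq_coprime uv_syz.
(* If p = 0 then q is itself a common divisor, so it is a unit. *)
have [p0|p_neq0] := eqVneq p 0.
  have [||a q_unit] := pq_coprime q.
  - by exists 0; rewrite p0 mul0r.
  - by exists 1; rewrite mul1r.
  have v0 : v = 0.
    by rewrite -[v]mulr1 q_unit mulrCA -uv_syz p0 !mulr0.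
  by exists (u * a); rewrite -mulrA -q_unit mulr1 p0 v0 mulr0.
have [u0 [v0 gen]] := syzygies_cyclic q p_neq0.
have [b [qE pE]] := gen q p (mulrC q p).
have [||c c_b] := pq_coprime b.
- by exists v0; rewrite mulrC.
- by exists u0; rewrite mulrC.
have [w [uE vE]] := gen u v uv_syz.
exists (w * c); rewrite {1}qE {1}pE uE vE.
by rewrite !mulrA -[w * c * b]mulrA -c_b mulr1.
Qed.

End BivariatePolynomials.

(** * Transport to K[x,y] *)

Section MpolyIso.
Variable K : fieldType.

Definition mpoly_to_polyXY : {mpoly K[2]} -> {poly {poly K}} :=
  mmap (polyC \o polyC) (fun i : 'I_2 => if i == 0 then 'X%:P else 'X).

Definition poly_to_mpoly : {poly K} -> {mpoly K[2]} :=
  horner_eval 'X_0 \o map_poly (@mpolyC 2 K).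

Definition polyXY_to_mpoly : {poly {poly K}} -> {mpoly K[2]} :=
  horner_eval 'X_1 \o map_poly poly_to_mpoly.

HB.instance Definition _ := GRing.RMorphism.on mpoly_to_polyXY.
HB.instance Definition _ := GRing.RMorphism.on poly_to_mpoly.
HB.instance Definition _ := GRing.RMorphism.on polyXY_to_mpoly.

Lemma poly_to_mpolyC (a : K) : poly_to_mpoly a%:P = a%:MP.
Proof. by rewrite /poly_to_mpoly /= map_polyC /horner_eval hornerC. Qed.

Lemma poly_to_mpolyX : poly_to_mpoly 'X = 'X_0.
Proof. by rewrite /poly_to_mpoly /= map_polyX /horner_eval hornerX. Qed.

Lemma polyXY_to_mpolyC (c : {poly K}) : polyXY_to_mpoly c%:P = poly_to_mpoly c.
Proof. by rewrite /polyXY_to_mpoly /= map_polyC /horner_eval hornerC. Qed.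

Lemma polyXY_to_mpolyX : polyXY_to_mpoly 'X = 'X_1.
Proof. by rewrite /polyXY_to_mpoly /= map_polyX /horner_eval hornerX. Qed.

Lemma mpoly_to_polyXYK : cancel mpoly_to_polyXY polyXY_to_mpoly.
Proof.
elim/mpolyind => [|a m p _ _ IH]; first by rewrite !rmorph0.
rewrite !rmorphD /= IH -mul_mpolyC !rmorphM /=; congr (_ * _ + _).
  by rewrite /mpoly_to_polyXY mmapC /= polyXY_to_mpolyC poly_to_mpolyC.
rewrite /mpoly_to_polyXY mmapX /mmap1 rmorph_prod /= mpolyXE_id.
apply: eq_bigr => i _; rewrite rmorphXn /=; congr (_ ^+ _).
have [->|i_neq0] := eqVneq i 0.
  by rewrite polyXY_to_mpolyC poly_to_mpolyX.
rewrite polyXY_to_mpolyX; congr 'X_ _; apply/val_inj.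
by case: i i_neq0 => [[|[|]]].
Qed.

Lemma polyXY_to_mpolyK : cancel polyXY_to_mpoly mpoly_to_polyXY.
Proof.
have X_img (i : 'I_2) : mpoly_to_polyXY 'X_i = if i == 0 then 'X%:P else 'X.
  by rewrite /mpoly_to_polyXY mmapX mmap1U.
have polyK (c : {poly K}) : mpoly_to_polyXY (poly_to_mpoly c) = c%:P.
  elim/poly_ind: c => [|c a IH]; first by rewrite !rmorph0.
  rewrite !(rmorphD, rmorphM) /= IH poly_to_mpolyX poly_to_mpolyC X_img eqxx.
  by rewrite /mpoly_to_polyXY mmapC.
elim/poly_ind => [|p c IH]; first by rewrite !rmorph0.
rewrite !(rmorphD, rmorphM) /= IH polyXY_to_mpolyC polyXY_to_mpolyX polyK.
by rewrite X_img.
Qed.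

Lemma trivial_syzygies_mpoly2 : trivial_syzygies {mpoly K[2]}.
Proof.
exact: trivial_syzygies_iso mpoly_to_polyXYK polyXY_to_mpolyK
  (@trivial_syzygies_polyXY K).
Qed.

End MpolyIso.

(** * The module of vector fields tangent to a curve *)

Lemma cofactors_only_unit_divisors (A : idomainType) (d p q : A) :
  d != 0 -> is_gcd d (p * d) (q * d) -> only_unit_divisors p q.
Proof.
move=> d_neq0 [_ _ d_max] e [a pE] [b qE].
have [||c dE] := d_max (e * d).
- by exists a; rewrite pE mulrA.
- by exists b; rewrite qE mulrA.
by exists c; apply: (mulIf d_neq0); rewrite mul1r {1}dE mulrA.
Qed.

Theorem theorem3 (R : realType) (S : {pred complex R}) (K : subFieldType S)
    (f D : {mpoly K[2]}) :
  nonconstant f ->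
  is_gcd D (dx f) (dy f) ->
  in_jacobian_ideal f f ->
  exists X1 Xs : vfield K,
    [/\ D *: X1 = hamiltonian f,
        V_ f Xs
      & freely_generated_by (V_ f) [tuple X1; Xs]].
Proof.
move=> f_nonconst D_gcd [a [b fE]].
have [[p pE] [q qE] _] := D_gcd.
have f_neq0 : f != 0.
  by apply/eqP => f0; apply: (f_nonconst 0); rewrite mpolyC0.
have fDg : f = (a * p + b * q) * D by rewrite {1}fE pE qE; ring.
have D_neq0 : D != 0 by apply: contraNneq f_neq0 => D0; rewrite fDg D0 mulr0.
have g_neq0 : a * p + b * q != 0.
  by apply: contraNneq f_neq0 => g0; rewrite fDg g0 mul0r.
have pq_coprime : only_unit_divisors p q.
  by apply: (cofactors_only_unit_divisors D_neq0); rewrite -pE -qE.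
have combE (c : 'I_2 -> {mpoly K[2]}) :
    \sum_i c i *: tnth [tuple ((- q, p) : vfield K); ((a, b) : vfield K)] i =
    (c 1 * a - c 0 * q, c 0 * p + c 1 * b) :> vfield K.
  rewrite !big_ord_recl big_ord0 addr0 /=.
  have -> : lift ord0 ord0 = 1 :> 'I_2 by apply/val_inj.
  by congr (_, _); rewrite /= /GRing.scale /=; ring.
exists (- q, p), (a, b); split.
- by congr (_, _); rewrite /= ?pE ?qE /GRing.scale /=; ring.
- by exists 1; rewrite mul1r [RHS]fE.
split=> [[P Q]|c].
  split=> [[k /= kE]|[c ->]]; last first.
    by rewrite combE; exists (c 1); rewrite /= [in RHS]fE pE qE; ring.
  (* P p + Q q = k g, rearranged into a syzygy of (p, q). *)
  have k_syz : (P - k * a) * p = (k * b - Q) * q.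
    apply: (mulIf D_neq0); apply/eqP; rewrite -subr_eq0; apply/eqP.
    transitivity (P * (p * D) + Q * (q * D) - k * ((a * p + b * q) * D)).
      by ring.
    by rewrite -pE -qE -fDg kE subrr.
  have [w [Pw Qw]] := trivial_syzygies_mpoly2 pq_coprime k_syz.
  exists (fun i => if i == 0 then - w else k); rewrite combE /=.
  congr (_, _).
    by rewrite -[P](subrK (k * a)) Pw; ring.
  by rewrite -[Q](subKr (k * b)) Qw; ring.
rewrite combE => comb0.
have comb0x : c 1 * a - c 0 * q = 0 := congr1 fst comb0.
have comb0y : c 0 * p + c 1 * b = 0 := congr1 snd comb0.
(* Pairing the combination with (p, q) kills (-q, p) and leaves c 1 * g. *)
have c1_0 : c 1 = 0.
  apply/eqP; move: g_neq0; apply: contraNT => c1_neq0.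
  rewrite -(mulrI_eq0 _ (mulfI c1_neq0)).
  have -> : c 1 * (a * p + b * q) =
    (c 1 * a - c 0 * q) * p + (c 0 * p + c 1 * b) * q by ring.
  by rewrite comb0x comb0y !mul0r addr0.
have c0_0 : c 0 = 0.
  apply/eqP; move: g_neq0; apply: contraNT => c0_neq0.
  have -> : p = 0.
    by apply: (mulfI c0_neq0); rewrite mulr0 -comb0y c1_0 mul0r addr0.
  have -> : q = 0.
    by apply: (mulfI c0_neq0); rewrite mulr0 -[RHS]oppr0 -comb0x c1_0; ring.
  by rewrite !mulr0 addr0.
move=> i; have [->//|i_neq0] := eqVneq i 0.
have -> : i = 1 by apply/val_inj; case: i i_neq0 => [[|[|]]].
exact: c1_0.
Qed.
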